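(* Let $a,b,p,q$ be complex numbers with $p\neq 0$, $q\neq 0$, and let $(W_j)$, $(U_j)$ be as defined in the context. If $m$ and $n$ are non-negative integers and $r,s,t$ are any integers, then \[ \sum_{k = 0}^n ( - q^s)^k \binom{m - n + k}{k} U_r^k U_s^{n - k} W_{r(n - k) - sk + t} = \sum_{k = 0}^n ( - q^s)^k \binom{m + 1}{k} U_r^k U_{r + s}^{n - k} W_{t - sk}. \]
   Context: The Horadam sequence $W_j=W_j(a,b;p,q)$ is defined by $W_0=a$, $W_1=b$, $W_j=pW_{j-1}-qW_{j-2}$ for $j\ge 2$, and extended to negative indices by $W_{-j}=\frac{1}{q}(pW_{-j+1}-W_{-j+2})$. The Lucas sequence of the first kind is $U_j=W_j(0,1;p,q)$. For a complex number $x$ and a non-negative integer $k$, $\binom{x}{k}=x(x-1)\cdots(x-k+1)/k!$ (so the upper index may be negative). *)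

(* Defs.v *)
From mathcomp Require Import all_boot all_order all_algebra.
From mathcomp Require Import reals complex.

Set Implicit Arguments.
Unset Strict Implicit.
Unset Printing Implicit Defensive.

Import GRing.Theory.
Local Open Scope ring_scope.

Section Horadam.
Variables (F : fieldType) (a b p q : F).

Fixpoint horadam_nat (j : nat) : F :=
  match j with
  | 0 => a
  | i.+1 => match i with
            | 0 => b
            | h.+1 => p * horadam_nat i - q * horadam_nat h
            end
  end.

(* [horadam_opp j] is W_(-j); at j = 1 the recurrence
   W_(-j) = q^-1 (p W_(-j+1) - W_(-j+2)) refers to W_0 = a and W_1 = b. *)
Fixpoint horadam_opp (j : nat) : F :=
  match j with
  | 0 => a
  | i.+1 => match i with
            | 0 => q^-1 * (p * a - b)
            | h.+1 => q^-1 * (p * horadam_opp i - horadam_opp h)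
            end
  end.

(* [Negz i] is the integer -(i + 1). *)
Definition horadam (j : int) : F :=
  match j with
  | Posz i => horadam_nat i
  | Negz i => horadam_opp i.+1
  end.

Lemma horadam0 : horadam 0 = a. Proof. by []. Qed.

Lemma horadam1 : horadam 1 = b. Proof. by []. Qed.

Lemma horadam_rec (j : nat) : (2 <= j)%N ->
  horadam j%:Z = p * horadam (j%:Z - 1) - q * horadam (j%:Z - 2).
Proof.
case: j => [|[|j]] // _.
have -> : j.+2%:Z - 1 = j.+1%:Z by rewrite -addn1 PoszD addrK.
by have -> : j.+2%:Z - 2 = j%:Z by rewrite -addn2 PoszD addrK.
Qed.

Lemma horadam_opp_rec (j : nat) : (1 <= j)%N ->
  horadam (- j%:Z)
  = q^-1 * (p * horadam (- j%:Z + 1) - horadam (- j%:Z + 2)).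
Proof.
case: j => [|[|[|j]]] // _.
have -> : - j.+3%:Z + 1 = - j.+2%:Z by rewrite -addn1 PoszD opprD addrNK.
by have -> : - j.+3%:Z + 2 = - j.+1%:Z by rewrite -addn2 PoszD opprD addrNK.
Qed.

End Horadam.

Definition lucasU (F : fieldType) (p q : F) (j : int) : F :=
  horadam 0 1 p q j.

(* Meaningful in characteristic 0 only, where k`! is invertible. *)
Definition gbinom (F : fieldType) (x : F) (k : nat) : F :=
  (\prod_(i < k) (x - i%:R)) / k`!%:R.

(* Main.v *)
(** The identity
      sum_k C(x - n + k, k) X^(n-k) Y^k = sum_k C(x + 1, k) Y^k (X - Y)^(n-k)
    holds for commuting X, Y, by induction on n with x varying: by Pascal's rule
    both sides S_n(x) satisfy S_(n+1)(x) = X S_n(x - 1) + C(x, n + 1) Y^(n+1).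
    With E the shift of sequences, take X = U_s E^r and Y = - q^s U_r E^(-s);
    on Horadam sequences X - Y acts as the scalar U_(r+s). *)
Require Import Defs.
From mathcomp Require Import all_boot all_order all_algebra.
From mathcomp Require Import reals complex.
From mathcomp Require Import ring zify.
Import GRing.Theory.
Local Open Scope ring_scope.

Lemma gbinom0 (F : fieldType) (x : F) : gbinom x 0 = 1.
Proof. by rewrite /gbinom big_ord0 fact0 divr1. Qed.

(** With the common product [x (x - 1) ... (x - k + 1)] factored out, the rule reduces to
    [x + 1 = (x - k) + (k + 1)]. *)
Lemma gbinom_pascal (F : numFieldType) (x : F) (k : nat) :
  gbinom (x + 1) k.+1 = gbinom x k.+1 + gbinom x k.
Proof.
have k1 : k.+1%:R != 0 :> F by rewrite Num.Theory.pnatr_eq0.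
have kf : k`!%:R != 0 :> F by rewrite Num.Theory.pnatr_eq0 -lt0n fact_gt0.
rewrite /gbinom big_ord_recl big_ord_recr /= factS natrM.
under eq_bigr => i _.
  have -> : x + 1 - (bump 0 i)%:R = x - i%:R by rewrite /bump /= natrD; ring.
  over.
move: k1; rewrite -natr1 => k1; field.
by rewrite kf k1.
Qed.

Section OperatorIdentity.
Variables (F : numFieldType) (r s : int) (u w y : F) (W : int -> F).
Hypothesis W_shift : forall t, u * W (t + r) = w * W t + y * W (t - s).

(** The left-hand operator sum applied to [W] and read at [t], for [X = u E^r] and [Y = y E^(-s)];
    [W_shift] says that [X - Y] acts as [w]. The upper index [x] is any field element because the
    induction lowers it. *)
Definition opsumL (n : nat) (x : F) (t : int) : F :=
  \sum_(0 <= k < n.+1) y ^+ k * gbinom (x - n%:R + k%:R) k * u ^+ (n - k)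
    * W (r * (n%:Z - k%:Z) - s * k%:Z + t).

Definition opsumR (n : nat) (x : F) (t : int) : F :=
  \sum_(0 <= k < n.+1) y ^+ k * gbinom (x + 1) k * w ^+ (n - k)
    * W (t - s * k%:Z).

(** [opsumR] combines translates of [W] with coefficients independent of [t], so it inherits
    [W_shift]. *)
Lemma opsumR_shift (n : nat) (x : F) (t : int) :
  u * opsumR n x (t + r) = w * opsumR n x t + y * opsumR n x (t - s).
Proof.
rewrite /opsumR !mulr_sumr -big_split; apply: eq_bigr => k _ /=.
have -> : t + r - s * k%:Z = t - s * k%:Z + r by ring.
have -> : t - s - s * k%:Z = t - s * k%:Z - s by ring.
rewrite mulrCA W_shift; ring.
Qed.

(** Lowering [n] and [x] together keeps [x - n + k] fixed, so each term with [k <= n] just releases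
    one factor [X]; the term [k = n + 1] remains. *)
Lemma opsumL_recl (n : nat) (x : F) (t : int) :
  opsumL n.+1 x t = u * opsumL n (x - 1) (t + r)
    + gbinom x n.+1 * y ^+ n.+1 * W (t - s * n.+1%:Z).
Proof.
rewrite /opsumL big_nat_recr //= subnn mulr_sumr; congr (_ + _).
  rewrite big_nat_cond [RHS]big_nat_cond; apply: eq_bigr => k /andP[/andP[_ kn] _].
  rewrite subSn // exprS.
  have -> : x - n.+1%:R + k%:R = x - 1 - n%:R + k%:R by rewrite -natr1; ring.
  have -> : r * (n.+1%:Z - k%:Z) - s * k%:Z + t
            = r * (n%:Z - k%:Z) - s * k%:Z + (t + r).
    by rewrite -addn1 PoszD; ring.
  ring.
rewrite subrK; have -> : r * (n.+1%:Z - n.+1%:Z) - s * n.+1%:Z + t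
            = t - s * n.+1%:Z by ring.
ring.
Qed.

Lemma opsumR_recl (n : nat) (x : F) (t : int) :
  opsumR n.+1 x t = w * opsumR n (x - 1) t + y * opsumR n (x - 1) (t - s)
    + gbinom x n.+1 * y ^+ n.+1 * W (t - s * n.+1%:Z).
Proof.
(* All the sums are written over the same terms [c k], so that only binomial coefficients remain to
   be compared. *)
pose c k := y ^+ k * w ^+ (n.+1 - k) * W (t - s * k%:Z).
have -> : opsumR n.+1 x t = \sum_(0 <= k < n.+2) gbinom (x + 1) k * c k.
  by apply: eq_bigr => k _; rewrite /c; ring.
have -> : w * opsumR n (x - 1) t = \sum_(0 <= k < n.+1) gbinom x k * c k.
  rewrite /opsumR mulr_sumr subrK big_nat_cond [RHS]big_nat_cond.
  apply: eq_bigr => k /andP[/andP[_ kn] _].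
  by rewrite /c subSn // exprS; ring.
have -> : y * opsumR n (x - 1) (t - s)
          = \sum_(0 <= k < n.+1) gbinom x k * c k.+1.
  rewrite /opsumR mulr_sumr subrK; apply: eq_bigr => k _.
  rewrite /c subSS exprS.
  have -> : t - s - s * k%:Z = t - s * k.+1%:Z by rewrite -addn1 PoszD; ring.
  ring.
have -> : gbinom x n.+1 * y ^+ n.+1 * W (t - s * n.+1%:Z)
          = gbinom x n.+1 * c n.+1 by rewrite /c subnn; ring.
(* The extra term completes the first sum up to [k = n + 1]; with [k = 0] split off, Pascal's rule
   applies termwise. *)
rewrite addrAC -big_nat_recr //= !(big_nat_recl n.+1) //= !gbinom0 -addrA.
congr (_ + _); rewrite -big_split; apply: eq_bigr => k _ /=.
by rewrite gbinom_pascal mulrDl.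
Qed.

Lemma opsumL_opsumR (n : nat) (x : F) (t : int) : opsumL n x t = opsumR n x t.
Proof.
elim: n x t => [|n IHn] x t.
  rewrite /opsumL /opsumR !big_nat1 !gbinom0.
  by congr (_ * W _); ring.
by rewrite opsumL_recl opsumR_recl IHn opsumR_shift.
Qed.

End OperatorIdentity.

Section TwoSidedRecurrence.
Variables (F : fieldType) (p q : F).
Hypothesis q_neq0 : q != 0.

Definition two_sided_rec (f : int -> F) : Prop :=
  forall j : int, f (j + 2) = p * f (j + 1) - q * f j.

(** Two consecutive zeros propagate upwards by the recurrence, and downwards because [q] can be
    cancelled. *)
Lemma two_sided_rec_eq0 (f : int -> F) :
  two_sided_rec f -> f 0 = 0 -> f 1 = 0 -> forall j, f j = 0.
Proof.
move=> f_rec f0 f1 j.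
suff /(_ j) [] : forall j : int, f j = 0 /\ f (j + 1) = 0 by [].
elim/int_rect => [|i [fi fi1]|i [fi fi1]]; first by rewrite add0r.
  rewrite -addn1 PoszD; split=> //.
  by rewrite -addrA f_rec fi fi1 !mulr0 subr0.
have e : - i.+1%:Z + 1 = - i%:Z by rewrite -addn1 PoszD; ring.
split; last by rewrite e.
have := f_rec (- i.+1%:Z).
have -> : - i.+1%:Z + 2 = - i%:Z + 1 by rewrite -e; ring.
rewrite e fi fi1 mulr0 sub0r => /esym/eqP.
by rewrite oppr_eq0 mulf_eq0 (negPf q_neq0) => /eqP.
Qed.

Lemma horadam_two_sided_rec (a b : F) : two_sided_rec (horadam a b p q).
Proof.
case=> j.
  have := @horadam_rec F a b p q j.+2 isT.
  have -> : j.+2%:Z - 1 = j%:Z + 1 by lia.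
  have -> : j.+2%:Z - 2 = j%:Z by lia.
  by have -> : j.+2%:Z = j%:Z + 2 by lia.
have := @horadam_opp_rec F a b p q j.+1 isT.
have -> : - j.+1%:Z = Negz j by lia.
by move=> ->; field.
Qed.

(** For fixed [s] and [j], the difference of the two sides solves the recurrence in [r], so it
    suffices that it vanishes at [r = 0] and [r = 1]. *)
Lemma lucasU_horadam_shift (a b : F) (r s j : int) :
  lucasU p q s * horadam a b p q (j + r)
  = lucasU p q (r + s) * horadam a b p q j
    - q ^ s * lucasU p q r * horadam a b p q (j - s).
Proof.
set W := horadam a b p q; set U := lucasU p q.
have W_rec : two_sided_rec W by apply: horadam_two_sided_rec.
have U_rec : two_sided_rec U by apply: horadam_two_sided_rec.
have U0 : U 0 = 0 by [].
have U1 : U 1 = 1 by [].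
(* The case [r = 1], by the same method in [i]: [q ^ i * W (j - i)] solves the recurrence, as
   [W_rec] at [j - (i + 2)] shows after multiplication by [q ^ (i + 1)]. *)
have shift1 : forall i, U i * W (j + 1) - U (i + 1) * W j + q ^ i * W (j - i) = 0.
  apply: two_sided_rec_eq0 => [i||].
  - have -> : i + 2 + 1 = i + 1 + 2 by ring.
    have -> : q ^ (i + 2) = q ^ i * q * q.
      by rewrite expfzDr // -mulrA -expr2.
    rewrite (U_rec (i + 1)) expfzDr // expr1z.
    have -> : i + 1 + 1 = i + 2 by ring.
    have := W_rec (j - (i + 2)).
    have -> : j - (i + 2) + 2 = j - i by ring.
    have -> : j - (i + 2) + 1 = j - (i + 1) by ring.
    move=> ->; rewrite U_rec; ring.
  - by rewrite U0 add0r U1 subr0 expr0z; ring.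
  - have -> : 1 + 1 = 0 + 2 :> int by [].
    have := W_rec (j - 1).
    have -> : j - 1 + 2 = j + 1 by ring.
    rewrite subrK U_rec add0r U0 U1 expr1z => ->; ring.
have := @two_sided_rec_eq0
  (fun i => U s * W (j + i) - U (i + s) * W j + q ^ s * U i * W (j - s)).
move=> /(_ _ _ _ r) D0; apply/eqP; rewrite -subr_eq0; apply/eqP.
rewrite -[RHS]D0; first by ring.
- move=> i /=; rewrite addrA W_rec U_rec.
  have -> : i + 2 + s = i + s + 2 by ring.
  have -> : i + 1 + s = i + s + 1 by ring.
  by rewrite U_rec addrA; ring.
- by rewrite U0 addr0 add0r; ring.
- by rewrite -[RHS](shift1 s) U1 mulr1 (addrC 1 s).
Qed.

End TwoSidedRecurrence.

Theorem theorem5 (R : realType) (a b p q : R[i]) (hp : p != 0) (hq : q != 0)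
    (m n : nat) (r s t : int) :
  \sum_(0 <= k < n.+1)
     (- q ^ s) ^+ k * gbinom (m%:R - n%:R + k%:R) k
     * lucasU p q r ^+ k * lucasU p q s ^+ (n - k)
     * horadam a b p q (r * (n%:Z - k%:Z) - s * k%:Z + t)
  = \sum_(0 <= k < n.+1)
     (- q ^ s) ^+ k * gbinom (m%:R + 1) k
     * lucasU p q r ^+ k * lucasU p q (r + s) ^+ (n - k)
     * horadam a b p q (t - s * k%:Z).
Proof.
have W_shift (t' : int) : lucasU p q s * horadam a b p q (t' + r)
    = lucasU p q (r + s) * horadam a b p q t'
      + (- q ^ s * lucasU p q r) * horadam a b p q (t' - s).
  by rewrite lucasU_horadam_shift // !mulNr.
have := @opsumL_opsumR R[i] _ _ _ _ _ _ W_shift n m%:R t; rewrite /opsumL /opsumR.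
under eq_bigr => k _ do rewrite exprMn (mulrAC (_ ^+ k)).
by under [in RHS]eq_bigr => k _ do rewrite exprMn (mulrAC (_ ^+ k)).
Qed.
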